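(* Let $(E,d)$ be a Polish space, let $\{\mu_\theta\}_{\theta\in\Theta}$ be a family of Borel probability measures on $E$ and let $\mu_{\mathrm{mix}}$ be its mixture with respect to a mixing probability measure $m$ on $\Theta$. Suppose that the measures $\mu_\theta$ satisfy the $\mathbf{T}_1$ inequality with uniformly bounded constants: $$C_\Theta:=\sup_{\theta\in\Theta}C_{\mathbf{T}_1}(\mu_\theta)<\infty .$$ Take any $x_0\in E$, denote $$B_\theta(x_0):=\int_E d(x,x_0)\,d\mu_\theta(x),\qquad\theta\in\Theta,$$ and suppose that $$N_\Theta:=\inf\Bigl\{t>0:\int_\Theta\exp\bigl(B_\theta(x_0)^2/t^2\bigr)\,dm(\theta)\le2\Bigr\}<\infty .$$ Then $\mu_{\mathrm{mix}}$ satisfies the $\mathbf{T}_1$ inequality and $$C_{\mathbf{T}_1}(\mu_{\mathrm{mix}})\le\bigl(N_\Theta^2+4C_\Theta\bigr)\Bigl(1+\tfrac32\log2\Bigr).$$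
   Context: Mixture: $(\Theta,\mathfrak{M},m)$ is a probability space, for every Borel set $A\subset E$ the map $\theta\mapsto\mu_\theta(A)$ is measurable, and $\mu_{\mathrm{mix}}(A):=\int_\Theta\mu_\theta(A)\,dm(\theta)$ for Borel $A\subset E$. Relative entropy: $H(\nu|\mu):=\int_E\log\bigl(\frac{d\nu}{d\mu}\bigr)d\nu$ if $\nu\ll\mu$ and $+\infty$ otherwise. Transport cost: $\mathcal{T}_d(\mu,\nu):=\inf_\pi\int_{E\times E}d(x,y)\,d\pi(x,y)$, the infimum over all couplings $\pi$ of $\mu$ and $\nu$. A Borel probability measure $\mu$ on $E$ satisfies the $\mathbf{T}_1$ inequality with constant $C\in(0,\infty)$ if $\mathcal{T}_d(\mu,\nu)\le\sqrt{2C\,H(\nu|\mu)}$ for all Borel probability measures $\nu$ on $E$. $C_{\mathbf{T}_1}(\mu)$ is the smallest such constant (infimum; $+\infty$ if there is none). *)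

(* Defs.v *)
From HB Require Import structures.
From mathcomp Require Import all_boot all_order all_algebra.
From mathcomp Require Import all_classical all_reals all_analysis measurable_realfun.

Set Implicit Arguments.
Unset Strict Implicit.
Unset Printing Implicit Defensive.

Import Order.TTheory GRing.Theory Num.Theory.

Local Open Scope classical_set_scope.
Local Open Scope ring_scope.

HB.mixin Record isSeparable T & Topological T := {
  separable_ex : exists2 D : set T, countable D & dense D }.

(* Complete separable metric spaces. Measurable types of the library must be
   pointed; this only excludes the empty space, which carries no probability
   measure. *)
#[short(type="polishMetricType")]
HB.structure Definition PolishMetric (K : numDomainType) :=
  { T of Complete T & PseudoPointedMetric K T & PseudoMetric_isMetric K T
       & isSeparable T }.

Definition borel (R : realType) (E : polishMetricType R) :=
  g_sigma_algebraType (@open E).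

Section mixture.
Local Open Scope ereal_scope.
Context d d' (Theta : measurableType d) (T : measurableType d') (R : realType).
Variables (m : probability Theta R) (mu : Theta -> probability T R).
Hypothesis mmu :
  forall A : set T, measurable A -> measurable_fun [set: Theta] (fun t => mu t A).

(* [let _ := mmu] records the measurability assumption in the term, so that the
   probability structure below can be inferred. *)
Definition mixture : set T -> \bar R :=
  let _ := mmu in fun A => \int[m]_t mu t A.

Let mixture0 : mixture set0 = 0.
Proof. by apply: integral0_eq => t _; rewrite measure0. Qed.

Let mixture_ge0 A : 0 <= mixture A.
Proof. exact: integral_ge0. Qed.

Let mixture_semi_sigma_additive : semi_sigma_additive mixture.
Proof.
move=> F mF tF mUF; rewrite [X in _ --> X](_ : _ =
    \int[m]_t \sum_(0 <= k <oo) mu t (F k)); last first.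
  apply: eq_integral => t _.
  by apply/esym/cvg_lim => //; exact: measure_semi_sigma_additive.
rewrite [X in X @ _ --> _](_ : _ =
    (fun n => \int[m]_t \sum_(0 <= i < n) mu t (F i))); last first.
  by apply/funext => n; rewrite -ge0_integral_sum// => k; exact: mmu.
apply: cvg_monotone_convergence => //.
- by move=> n; apply: emeasurable_sum => k; exact: mmu.
- by move=> n t _; rewrite sume_ge0.
- by move=> t _ k n kn; exact: ereal_nondecreasing_series.
Qed.

HB.instance Definition _ := isMeasure.Build d' T R mixture
  mixture0 mixture_ge0 mixture_semi_sigma_additive.

Let mixture_setT : mixture [set: T] = 1.
Proof.
transitivity (\int[m]_t cst 1 t).
  by apply: eq_integral => t _; exact: probability_setT.
by rewrite integral_cst// mul1e; exact: probability_setT.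
Qed.

HB.instance Definition _ :=
  Measure_isProbability.Build d' T R mixture mixture_setT.

End mixture.

(* The Radon-Nikodym derivative is a version that may be <= 0, where lne is -oo,
   but only on a nu-null set. *)
Definition rel_entropy d (T : measurableType d) (R : realType)
    (nu mu : probability T R) : \bar R :=
  if `[< nu `<< mu >] then
    (\int[nu]_x lne (Radon_Nikodym (charge_of_finite_measure nu) mu x))%E
  else +oo%E.

Section transport.
Local Open Scope ereal_scope.
Context (R : realType) (E : polishMetricType R).
Implicit Types mu nu : probability (borel E) R.

(* As E is separable, the product sigma-algebra on E * E is the Borel one. *)
Definition coupling mu nu : set (probability (borel E * borel E)%type R) :=
  [set pi | forall A : set (borel E), measurable A ->
    pi (A `*` setT) = mu A /\ pi (setT `*` A) = nu A].

Definition transport_cost mu nu : \bar R :=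
  ereal_inf [set \int[pi]_z (mdist (z.1 : E) (z.2 : E))%:E
            | pi in coupling mu nu].

Definition T1_ineq mu (C : R) : Prop :=
  (0 < C)%R /\
  forall nu, transport_cost mu nu <= sqrte ((2 * C)%:E * rel_entropy nu mu).

Definition T1_const mu : \bar R := ereal_inf [set C%:E | C in T1_ineq mu].

Definition mean_dist mu (x0 : E) : \bar R :=
  \int[mu]_x (mdist (x : E) x0)%:E.

Section family.
Context d (Theta : measurableType d).
Variables (m : probability Theta R) (mu : Theta -> probability (borel E) R).

Definition unif_T1_const : \bar R := ereal_sup [set T1_const (mu t) | t in setT].

Definition mean_dist_psi2 (x0 : E) : \bar R :=
  ereal_inf [set s%:E | s in [set s : R | (0 < s)%R /\
    \int[m]_t expeR (mean_dist (mu t) x0 ^+ 2 / (s ^+ 2)%:E) <= 2%:E]].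

End family.
End transport.

(* Main.v *)
From HB Require Import structures.
Require Import Defs.
From mathcomp Require Import all_boot all_order all_algebra.
From mathcomp Require Import all_classical all_reals all_analysis measurable_realfun.
From mathcomp Require Import ring lra.
Import Order.TTheory GRing.Theory Num.Theory.
Import numFieldNormedType.Exports.
Local Open Scope classical_set_scope.
Local Open Scope ring_scope.
Set Implicit Arguments.
Unset Strict Implicit.
Unset Printing Implicit Defensive.

(** Two implications are chained through the Gaussian moments
    G_alpha(P) = int exp(alpha d(x,x0)^2) dP.

    From T1 to Gaussian moments.  If P satisfies T1 with constant C, then
    testing T1 on the tilted measure exp(s F)/Z dP bounds the Laplace transform
    of every bounded nonnegative 1-Lipschitz F (T1_laplace):
    int exp(s F) dP <= exp(s int F dP + C s^2/2).  Averaging over a Gaussian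
    parameter s turns this into a bound on int exp(alpha F^2) dP
    (integral_exp_sqr_le).  With alpha = 1/(s^2 + 4C) and F increasing to
    d(.,x0) it reads G_alpha(mu_t) <= sqrt 2 exp(B_t^2/s^2), where B_t is the
    mean distance to x0 (gaussian_moment_of_T1).  This estimate is linear in
    the measure, so it can be integrated in t: when s is admissible in the
    definition of N, the mixture satisfies G_alpha <= 2 sqrt 2 = exp(3/2 ln 2).

    From Gaussian moments back to T1 (T1_ineq_of_gaussian).  If nu = h mu, the
    coupling that leaves the common mass min(h,1) mu in place and moves the rest
    independently costs at most int d(x,x0) |h - 1| dmu
    (transport_cost_le_density).  This weighted total variation is controlled by
    a Pinsker inequality whose weight d(x,x0)^2 is integrated through the Gibbs
    variational principle (second_moment_density): G_alpha(mu) <= exp L yields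
    T1 with constant (1 + L)/alpha.  For alpha = 1/(s^2 + 4C) and
    L = 3/2 ln 2 this is (s^2 + 4C)(1 + 3/2 ln 2), and s, C decrease to their
    infima. *)

(** * Scalar inequalities *)

Section scalar_inequalities.
Context {R : realType}.
Implicit Types h a w M b C s m : R.

(** The integrand of the relative entropy, normalized to be nonnegative and to
    vanish exactly at 1, so that it can be integrated without sign conditions. *)
Definition entropy_fun h : R := h * ln h - h + 1.

(** The difference of the two sides vanishes at 1 and its derivative is
    (h-1)^3 / (h^2 (h+2)^2), which has the sign of h - 1. *)
Lemma ln_ge_rational h : 0 < h ->
  (h - 1) * (5 * h + 1) / (2 * h * (h + 2)) <= ln h.
Proof.
move=> h0.
pose q (x : R) := (x - 1) * (5 * x + 1) / (2 * x * (x + 2)).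
pose k (x : R) := ln x - q x.
pose k' (x : R) := (x - 1) ^+ 3 / (x ^+ 2 * (x + 2) ^+ 2).
have dk (x : R) : 0 < x -> is_derive x 1 k (k' x).
  move=> x0.
  have x20 : x + 2 != 0 by rewrite gt_eqF// addr_gt0.
  have xx0 : 2 * x * (x + 2) != 0 by rewrite !mulf_neq0// gt_eqF.
  have dl := is_derive1_ln x0.
  rewrite /k /q; apply: is_derive_eq.
  rewrite /k' /GRing.scale/=.
  by field; rewrite x20 gt_eqF.
have ck (x y : R) : 0 < x -> {within `[x, y], continuous k}.
  move=> x0; apply: derivable_within_continuous => z.
  rewrite in_itv/= => /andP[xz _].
  by have /@ex_derive := dk z (lt_le_trans x0 xz).
have k1 : k 1 = 0 by rewrite /k /q ln1 subrr !mul0r subr0.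
suff : 0 <= k h by rewrite /k subr_ge0.
have [h1|h1|->] := ltgtP h 1; last by rewrite k1.
- have [||c] := @MVT _ k k' h 1 h1; last 2 first.
  + exact: ck.
  + rewrite in_itv/= => /andP[hc c1]; rewrite k1 sub0r => /eqP.
    rewrite eqr_oppLR => /eqP ->; rewrite -mulNr mulr_ge0 ?subr_ge0 ?(ltW h1)//.
    rewrite /k' -mulNr divr_ge0//; last by rewrite mulr_ge0 ?sqr_ge0.
    by rewrite oppr_ge0 exprS mulr_le0_ge0 ?sqr_ge0// subr_le0 ltW.
  by move=> x; rewrite in_itv/= => /andP[hx _]; exact/dk/(lt_trans h0).
- have [||c] := @MVT _ k k' 1 h h1; last 2 first.
  + exact: ck.
  + rewrite in_itv/= => /andP[c1 hc]; rewrite k1 subr0 => ->.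
    rewrite mulr_ge0 ?subr_ge0 ?(ltW h1)//.
    rewrite divr_ge0 ?exprn_ge0 ?subr_ge0 ?(ltW c1)//.
    by rewrite mulr_ge0 ?sqr_ge0.
  by move=> x; rewrite in_itv/= => /andP[hx _]; exact/dk/(lt_trans ltr01).
Qed.

(** The pointwise form of Pinsker's inequality: together with Cauchy-Schwarz it
    bounds a weighted L1 norm of h - 1 by the entropy. *)
Lemma sqr_sub1_le_entropy h : 0 <= h ->
  3 * (h - 1) ^+ 2 <= (4 + 2 * h) * entropy_fun h.
Proof.
rewrite le_eqVlt => /predU1P[<-|h0].
  by rewrite /entropy_fun mul0r; lra.
have := ln_ge_rational h0.
rewrite ler_pdivrMr; last by rewrite !mulr_gt0// addr_gt0.
rewrite /entropy_fun; lra.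
Qed.

(** Legendre duality between the entropy and the exponential: the pointwise
    Gibbs variational principle. *)
Lemma young_entropy a h : 0 <= h -> a * h + 1 <= entropy_fun h + expR a.
Proof.
rewrite le_eqVlt => /predU1P[<-|h0].
  by rewrite /entropy_fun mulr0 mul0r subr0 !add0r lerDl expR_ge0.
have : h * (1 + (a - ln h)) <= h * expR (a - ln h).
  by rewrite ler_pM2l// expR_ge1Dx.
rewrite expRD expRN lnK ?posrE// mulrCA mulfV ?gt_eqF// mulr1.
by rewrite /entropy_fun; lra.
Qed.

Lemma entropy_fun_ge0 h : 0 <= h -> 0 <= entropy_fun h.
Proof. by move=> /(young_entropy 0); rewrite expR0 mul0r; lra. Qed.

(** Optimizing the arithmetic-geometric mean inequality over its parameter; the
    optimum e = sqrt (b / M) degenerates when b = 0, which is treated apart. *)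
Lemma le_sqrt_of_le_mean w M b : 0 < M -> 0 <= b ->
  (forall e, 0 < e -> w <= (e * M + b / e) / 2) -> w <= Num.sqrt (M * b).
Proof.
move=> M0; rewrite le_eqVlt => /predU1P[<-|b0] H.
  rewrite mulr0 sqrtr0; apply/ler_addgt0Pr => e e0; rewrite add0r.
  have := H (e / M) (divr_gt0 e0 M0).
  by rewrite mul0r addr0 divfK ?gt_eqF// => /le_trans; apply; lra.
have s0 : 0 < Num.sqrt (M * b) by rewrite sqrtr_gt0 mulr_gt0.
have := H (Num.sqrt (M * b) / M) (divr_gt0 s0 M0).
rewrite divfK ?gt_eqF// invf_div mulrA (mulrC b).
have -> : M * b / Num.sqrt (M * b) = Num.sqrt (M * b).
  rewrite -{1}(@sqr_sqrtr _ (M * b)) ?mulr_ge0 ?ltW//.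
  by rewrite expr2 mulfK ?gt_eqF.
by move=> /le_trans; apply; lra.
Qed.

(** The choice of alpha gives 1 - 2 C' alpha >= 1/2, whence the factor sqrt 2,
    and alpha s^2 <= 1 - 2 C' alpha, whence the exponent m^2/s^2. *)
Lemma sharp_parameters C C' s m : (0 < C) -> (0 < s) -> (C' <= C) ->
  let alpha := ((s ^+ 2 + 4 * C)^-1) in
  (2 * C' * alpha < 1) /\
  (expR (alpha * m ^+ 2 / (1 - 2 * C' * alpha)) / Num.sqrt (1 - 2 * C' * alpha) <=
   Num.sqrt 2 * expR (m ^+ 2 / s ^+ 2)).
Proof.
move=> C0 s0 C'C alpha; have s20 : (0 < s ^+ 2) by rewrite exprn_gt0.
have D0 : (0 < s ^+ 2 + 4 * C) by lra.
have a0 : (0 < alpha) by rewrite invr_gt0.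
have aD : (alpha * (s ^+ 2 + 4 * C) = 1) by rewrite mulVf ?gt_eqF.
have CaC : (C' * alpha <= C * alpha) by rewrite ler_wpM2r// ltW.
have as0 : (0 < alpha * s ^+ 2) by rewrite mulr_gt0.
have aC0 : (0 < C * alpha) by rewrite mulr_gt0.
have b2 : (2^-1 <= 1 - 2 * C' * alpha) by lra.
have b0 : (0 < 1 - 2 * C' * alpha) by lra.
split; first by lra.
rewrite mulrC ler_pM ?invr_ge0 ?expR_ge0 ?sqrtr_ge0//.
- rewrite -sqrtrV ?(ltW b0)// ler_wsqrtr// -[leRHS]invrK.
  by rewrite lef_pV2 ?posrE ?invr_gt0.
- rewrite ler_expR ler_pdivrMr// mulrAC ler_pdivlMr// mulrAC mulrC.
  by rewrite ler_wpM2l ?sqr_ge0//; lra.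
Qed.

End scalar_inequalities.

(** * Integration against mixtures and densities *)

Section integral_bind.
Local Open Scope ereal_scope.
Context d d' (X : measurableType d) (Y : measurableType d') (R : realType).
Variables (m : {measure set X -> \bar R}) (k : X -> {measure set Y -> \bar R}).
Hypothesis mk : forall A, measurable A -> measurable_fun [set: X] (k ^~ A).
Variable nu : {measure set Y -> \bar R}.
Hypothesis nuE : forall A, measurable A -> nu A = \int[m]_x k x A.

Import HBNNSimple.

Let ge0_integral_bind_nnsfun (f : {nnsfun Y >-> R}) :
  \int[nu]_y (f y)%:E = \int[m]_x \int[k x]_y (f y)%:E.
Proof.
rewrite integralT_nnsfun sintegralE.
under [RHS]eq_integral do rewrite integralT_nnsfun sintegralE.
rewrite ge0_integral_fsum//; last 2 first.
- by move=> r; apply: measurable_funeM; exact: mk.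
- move=> r x _; have := mulemu_ge0 (fun r => f @^-1` [set r]).
  by apply; exact: preimage_nnfun0.
apply: eq_fsbigr => r _; rewrite nuE//.
have [r0|r0] := leP 0%R r.
  by rewrite ge0_integralZl//; exact: mk.
rewrite preimage_nnfun0// !integral0_eq ?mule0// => x _.
by rewrite measure0 mule0.
Qed.

(** Monotone approximation by simple functions reduces this to the defining
    identity on sets.  It serves for mixtures and, with weighted Dirac masses
    for k, for measures given by a density. *)
Lemma ge0_integral_bind (f : Y -> \bar R) : (forall y, 0 <= f y) ->
  measurable_fun [set: Y] f -> \int[nu]_y f y = \int[m]_x \int[k x]_y f y.
Proof.
move=> f0 mf; pose f_ := nnsfun_approx measurableT mf.
have mf_ n : measurable_fun [set: Y] (fun y => (f_ n y)%:E).
  exact/measurable_EFinP.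
have f_0 n y : 0 <= (f_ n y)%:E by rewrite lee_fin.
have ndf_ y : {homo (fun n => (f_ n y)%:E) : a b / (a <= b)%N >-> a <= b}.
  by move=> a b ab; rewrite lee_fin; exact/lefP/nd_nnsfun_approx.
have intf (l : {measure set Y -> \bar R}) :
    \int[l]_y f y = limn (fun n => \int[l]_y (f_ n y)%:E).
  rewrite -monotone_convergence//.
  by apply: eq_integral => y _; apply/esym/cvg_lim => //; exact: cvg_nnsfun_approx.
rewrite intf; under eq_fun do rewrite ge0_integral_bind_nnsfun.
rewrite -monotone_convergence//.
- by apply: eq_integral => x _; rewrite intf.
- by move=> n; exact: measurable_fun_integral_kernel.
- by move=> n x _; exact: integral_ge0.
- by move=> x _ a b ab; apply: ge0_le_integral => // y _; exact: ndf_.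
Qed.

End integral_bind.

Section density.
Local Open Scope ereal_scope.
Context d (T : measurableType d) (R : realType).
Implicit Types mu nu : {measure set T -> \bar R}.

Definition has_density nu mu (h : T -> R) := forall A, measurable A ->
  nu A = \int[mu]_(x in A) (h x)%:E.

Lemma ge0_integral_density mu nu (h : T -> R) (f : T -> \bar R) :
  measurable_fun [set: T] h -> (forall x, (0 <= h x)%R) ->
  has_density nu mu h ->
  (forall x, 0 <= f x) -> measurable_fun [set: T] f ->
  \int[nu]_x f x = \int[mu]_x (f x * (h x)%:E).
Proof.
move=> mh h0 nuE f0 mf.
pose k (x : T) : {measure set T -> \bar R} := mscale (NngNum (h0 x)) \d_x.
rewrite (@ge0_integral_bind _ _ _ _ _ mu k)//.
- apply: eq_integral => x _; rewrite ge0_integral_mscale//= integral_dirac//.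
  by rewrite diracT mul1e muleC.
- move=> A mA; rewrite /k /= /mscale/=; apply: emeasurable_funM.
    exact/measurable_EFinP.
  by apply/measurable_EFinP; exact: measurable_indic.
- move=> A mA; rewrite nuE// integral_mkcond; apply: eq_integral => x _.
  rewrite /k/= /mscale/= patchE diracE; case: (x \in A); rewrite ?mule1 ?mule0//.
Qed.

End density.

Lemma integral_cst_probability d (T : measurableType d) (R : realType)
  (P : probability T R) (c : R) : (\int[P]_x c%:E = c%:E)%E.
Proof.
transitivity (c%:E * P setT)%E; first exact: integral_cst.
by rewrite probability_setT mule1.
Qed.

Lemma integral_bounded_fin_num d (T : measurableType d) (R : realType)
    (P : probability T R) (f : T -> R) (M : R) :
  measurable_fun [set: T] f -> (forall x, 0 <= f x <= M) ->
  (\int[P]_x (f x)%:E)%E \is a fin_num.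
Proof.
move=> mf fM; have f0 x : (0 <= (f x)%:E)%E by rewrite lee_fin; case/andP: (fM x).
rewrite ge0_fin_numE ?integral_ge0//.
apply: (@le_lt_trans _ _ (\int[P]_x M%:E)%E).
  apply: ge0_le_integral => //; first exact/measurable_EFinP.
  by move=> x _; rewrite lee_fin; case/andP: (fM x).
by rewrite integral_cst_probability ltry.
Qed.

Lemma measurable_lne (R : realType) : measurable_fun [set: \bar R] (@lne R).
Proof.
move=> mD; apply: (measurability _ (ErealGenOInfty.measurableE R)) => //.
move=> _ [_ [r ->] <-].
rewrite (_ : _ @^-1` _ = `](expR r)%:E, +oo[%classic).
  by apply: measurableI => //; exact: emeasurable_itv.
apply/seteqP; split => x /=; rewrite !in_itv/= !andbT => rx.
- have x0 : (0 < x)%E by rewrite ltNge; apply/negP => /le0_lneNy xN; rewrite xN in rx.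
  rewrite -(@lneK _ x) ?in_itv/= ?leey ?(ltW x0)//.
  by rewrite -[(expR r)%:E]/(expeR r%:E) lte_expeR.
- rewrite -lte_expeR lneK ?in_itv//= leey andbT ltW//.
  by rewrite (lt_trans _ rx)// lte_fin expR_gt0.
Qed.

Lemma measurable_expeR (R : realType) : measurable_fun [set: \bar R] (@expeR R).
Proof.
move=> mD; apply: (measurability _ (ErealGenOInfty.measurableE R)) => //.
move=> _ [_ [r ->] <-]; rewrite setTI.
have [r0|r0] := ltP r 0.
  rewrite (_ : _ @^-1` _ = setT)//; apply/seteqP; split => x //= _.
  by rewrite in_itv/= andbT (lt_le_trans _ (expeR_ge0 x))// lte_fin.
have [l lE] : exists l : \bar R, forall x, (l < x)%E = (r%:E < expeR x)%E.
  exists (lne r%:E) => x; rewrite -lte_expeR lneK// in_itv/= lee_fin r0.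
  exact: leey.
rewrite (_ : _ @^-1` _ = `]l, +oo[%classic); first exact: emeasurable_itv.
by apply/seteqP; split => x /=; rewrite !in_itv/= !andbT lE.
Qed.

(** * Densities and relative entropy *)

Section density_measure.
Local Open Scope ereal_scope.
Context d (T : measurableType d) (R : realType).
Variables (mu : {measure set T -> \bar R}) (h : T -> R).
Hypothesis mh : measurable_fun [set: T] h.
Hypothesis h0 : forall x, (0 <= h x)%R.

(** The vacuous [let]s keep measurability and nonnegativity in the term, where
    the inference of the measure structure finds them. *)
Definition density_measure : set T -> \bar R :=
  let _ := mh in let _ := h0 in fun A => \int[mu]_(x in A) (h x)%:E.

Let density0 : density_measure set0 = 0.
Proof. exact: integral_set0. Qed.

Let density_ge0 A : 0 <= density_measure A.
Proof. by apply: integral_ge0 => x _; rewrite lee_fin. Qed.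

Let density_sigma_additive : semi_sigma_additive density_measure.
Proof.
apply: semi_sigma_additive_nng_induced; first exact/measurable_EFinP.
by move=> x; rewrite lee_fin.
Qed.

HB.instance Definition _ := isMeasure.Build d T R density_measure
  density0 density_ge0 density_sigma_additive.

End density_measure.

Section density_existence.
Local Open Scope ereal_scope.
Context d (T : measurableType d) (R : realType) (mu : probability T R).

Lemma exists_density (nu : probability T R) : nu `<< mu ->
  exists h : T -> R, [/\ measurable_fun [set: T] h, forall x, (0 <= h x)%R &
                has_density nu mu h].
Proof.
move=> numu; pose f := Radon_Nikodym_SigmaFinite.f nu mu.
have fE x : f x = (fine (f x))%:E.
  by rewrite fineK// Radon_Nikodym_SigmaFinite.f_fin_num.
exists (fine \o f); split.
- apply/measurable_EFinP; rewrite (_ : _ \o _ = f).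
    exact: measurable_int (Radon_Nikodym_SigmaFinite.f_integrable numu).
  by apply/funext => x /=; rewrite -fE.
- by move=> x; rewrite fine_ge0// Radon_Nikodym_SigmaFinite.f_ge0.
- move=> A mA; apply: etrans (Radon_Nikodym_SigmaFinite.f_integral numu mA) _.
  by apply: eq_integral => x _ /=; rewrite -fE.
Qed.

Lemma exists_probability_density (h : T -> R) :
  measurable_fun [set: T] h -> (forall x, (0 <= h x)%R) ->
  \int[mu]_x (h x)%:E = 1 -> exists nu : probability T R, has_density nu mu h.
Proof.
move=> mh h0 h1.
pose p := Measure_isProbability.Build d T R (density_measure mu mh h0) h1.
pose nu : probability T R := HB.pack (density_measure mu mh h0) p.
by exists nu.
Qed.

Lemma has_density_dominates (nu : probability T R) (h : T -> R) :
  measurable_fun [set: T] h -> has_density nu mu h -> nu `<< mu.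
Proof.
move=> mh nuE; apply/null_content_dominatesP => A mA muA0.
rewrite nuE//; apply: null_set_integral => //.
exact/measurable_funTS/measurable_EFinP.
Qed.

(** Any density agrees with the Radon-Nikodym derivative almost everywhere.  The
    two integrals match also where h = 0: nu does not charge that set, on which
    lne h is -oo, and h ln h = 0 there. *)
Lemma rel_entropy_density (nu : probability T R) (h : T -> R) :
  measurable_fun [set: T] h -> (forall x, (0 <= h x)%R) ->
  has_density nu mu h ->
  rel_entropy nu mu = \int[mu]_x (h x * ln (h x))%:E.
Proof.
move=> mh h0 nuE; have numu := has_density_dominates mh nuE.
rewrite /rel_entropy; case: ifPn => [_|/asboolP//].
set rn := Radon_Nikodym _ _.
have mEh : measurable_fun [set: T] (EFin \o h) by exact/measurable_EFinP.
have irn : mu.-integrable [set: T] rn by exact: Radon_Nikodym_integrable.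
have mrn : measurable_fun [set: T] rn by exact: measurable_int irn.
have rnh : ae_eq nu setT rn (EFin \o h).
  apply: (null_dominates_ae_eq measurableT numu); apply: integral_ae_eq => //.
  by move=> A _ mA; rewrite -Radon_Nikodym_integral//; exact: nuE.
have mlh : measurable_fun [set: T] (fun x => lne (h x)%:E).
  exact: measurableT_comp (@measurable_lne R) mEh.
transitivity (\int[nu]_x lne (h x)%:E).
  apply: ae_eq_integral => //.
    exact: measurableT_comp (@measurable_lne R) mrn.
  by apply: filterS rnh => x /= rnx _; rewrite rnx.
rewrite [LHS]integralE [RHS]integralE.
have hE x : lne (h x)%:E * (h x)%:E = (h x * ln (h x))%:E.
  rewrite /lne; case: ifPn => [hx0|_]; last by rewrite -EFinM mulrC.
  have -> : h x = 0%R by apply/eqP; rewrite eq_le hx0 h0.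
  by rewrite mule0 mul0r.
congr (_ - _).
- rewrite (ge0_integral_density mh h0 nuE)//; last exact: measurable_funepos.
  apply: eq_integral => x _; rewrite !funeposE -hE maxe_pMl ?lee_fin//.
  by rewrite mul0e.
- rewrite (ge0_integral_density mh h0 nuE)//; last exact: measurable_funeneg.
  apply: eq_integral => x _; rewrite !funenegE -hE maxe_pMl ?lee_fin//.
  by rewrite mul0e mulNe.
Qed.

End density_existence.

(** * Measurability in a Polish space *)

Section borel_metric.
Context {R : realType} {E : polishMetricType R}.
Implicit Types (x y : E) (F : E -> R).

Lemma measurable_lipschitz F :
  (forall x y, F y <= F x + mdist x y) -> measurable_fun [set: borel E] F.
Proof.
move=> FL; apply: (measurability _ (RGenOpens.measurableE R)) => //.
move=> _ [_ [a [b ->] <-]]; rewrite setTI; apply: sub_sigma_algebra.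
rewrite openE => x; rewrite /= in_itv/= => /andP[aF Fb].
pose e := Num.min (F x - a) (b - F x).
have e0 : 0 < e by rewrite lt_min !subr_gt0 aF.
apply/nbhs_ballP; exists e => //= y; rewrite ballEmdist/= lt_min => /andP[xya xyb].
rewrite in_itv/=; have := FL x y; have := FL y x; rewrite (metric_sym y x); lra.
Qed.

Lemma measurable_mdistr x0 :
  measurable_fun [set: borel E] (fun x => mdist (x : E) x0).
Proof.
apply: measurable_lipschitz => x y.
by rewrite addrC (metric_sym x y); exact: metric_triangle.
Qed.

Lemma exists_dense_seq :
  exists q : nat -> E, forall x e, 0 < e -> exists n, mdist x (q n) < e.
Proof.
have [D /countable_injP[f fI] dD] :
  exists2 D : set E, countable D & dense D := separable_ex.
exists (fun n => xget point [set y | D y /\ f y = n]) => x e e0.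
have [||y [xy Dy]] := dD (ball x e).
- by exists x; exact: ballxx.
- rewrite openE => y; rewrite ballEmdist/= => xye.
  apply/nbhs_ballP; exists (e - mdist x y); first by rewrite /= subr_gt0.
  move=> z; rewrite ballEmdist/= => yz.
  have := metric_triangle x y z; lra.
exists (f y); have [//|Dz fz] := @xgetPex _ point [set z | D z /\ f z = f y].
  by exists y.
by rewrite (fI _ _ _ _ fz) ?inE//; move: xy; rewrite ballEmdist.
Qed.

(** The distance is the infimum of d(x,q) + d(q,y) over a dense sequence of
    points q, a countable infimum of functions measurable for the product
    sigma-algebra. *)
Lemma measurable_mdist : measurable_fun [set: borel E * borel E]
  (fun z => mdist (z.1 : E) (z.2 : E)).
Proof.
have [q dq] := exists_dense_seq.
pose g (z : borel E * borel E) n : \bar R :=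
  (mdist (z.1 : E) (q n) + mdist (z.2 : E) (q n))%:E.
apply/measurable_EFinP.
rewrite (_ : _ \o _ = fun z => einfs (fun n => g z n) 0%N).
  apply: (measurable_fun_einfs (f := fun n z => g z n)) => n.
  apply/measurable_EFinP; apply: measurable_funD.
    by apply: measurableT_comp (measurable_mdistr (q n)) _; exact: measurable_fst.
  by apply: measurableT_comp (measurable_mdistr (q n)) _; exact: measurable_snd.
apply/funext => -[x y] /=; apply/eqP; rewrite eq_le; apply/andP; split.
  apply: le_ereal_inf_tmp => _ [n _ <-]; rewrite lee_fin (metric_sym y).
  exact: metric_triangle.
apply/lee_addgt0Pr => e e0; have [n xqn] := dq x _ (divr_gt0 e0 (ltr0n R 2)).
apply: (@le_trans _ _ (g (x, y) n)).
  by apply: ereal_inf_lbound; exists n.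
rewrite lee_fin/=; have := metric_triangle y x (q n).
rewrite (metric_sym y x); lra.
Qed.

End borel_metric.

(** * Bounds on the transport cost *)

Section normalized_density.
Local Open Scope ereal_scope.
Context d (T : measurableType d) (R : realType) (mu : probability T R).

(** A finite measure written as its mass times a probability measure; the
    formulation by integrals also covers mass 0, when any P will do. *)
Lemma exists_normalized_density (g : T -> R) (a : R) :
  measurable_fun [set: T] g -> (forall x, (0 <= g x)%R) ->
  \int[mu]_x (g x)%:E = a%:E ->
  exists P : probability T R, forall f, (forall x, 0 <= f x) ->
    measurable_fun [set: T] f ->
    a%:E * \int[P]_x f x = \int[mu]_x (f x * (g x)%:E).
Proof.
move=> mg g0 ga; have mEg : measurable_fun [set: T] (EFin \o g).
  exact/measurable_EFinP.
have g0E x : 0 <= (g x)%:E by rewrite lee_fin.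
have : (0 <= a)%R by rewrite -lee_fin -ga integral_ge0.
rewrite le_eqVlt => /predU1P[a0|a0].
  exists mu => f f0 mf; rewrite -a0 mul0e.
  have zg : has_density mzero mu g.
    move=> A mA; apply/eqP; rewrite eq_le integral_ge0//=.
    apply: (@le_trans _ _ a%:E); last by rewrite -a0.
    by rewrite -ga; exact: ge0_subset_integral.
  by rewrite -(ge0_integral_density mg g0 zg f0 mf) integral_measure_zero.
have ga0 x : (0 <= g x / a)%R by rewrite divr_ge0// ltW.
have mga : measurable_fun [set: T] (fun x => g x / a)%R.
  exact: measurable_funM.
have [|P Pg] := @exists_probability_density _ _ _ mu _ mga ga0.
  under eq_integral do rewrite EFinM.
  by rewrite ge0_integralZr ?lee_fin ?invr_ge0 ?ltW// ga -EFinM mulfV ?gt_eqF.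
exists P => f f0 mf; rewrite (ge0_integral_density mga ga0 Pg)//.
rewrite -ge0_integralZl//; last 3 first.
- by apply: emeasurable_funM => //; exact/measurable_EFinP.
- by move=> x _; rewrite mule_ge0// lee_fin.
- by rewrite lee_fin ltW.
by apply: eq_integral => x _; rewrite muleCA -EFinM mulrCA mulfV ?gt_eqF// mulr1.
Qed.

End normalized_density.

Section transport_bounds.
Local Open Scope ereal_scope.
Context (R : realType) (E : polishMetricType R).
Implicit Types (mu nu : probability (borel E) R) (F : E -> R).

Lemma coupling_integral_fst mu nu pi (f : borel E -> \bar R) :
  coupling mu nu pi -> measurable_fun setT f -> (forall x, 0 <= f x) ->
  \int[pi]_z f z.1 = \int[mu]_x f x.
Proof.
move=> cpi mf f0.
pose mx := isMeasurableFun.Build _ _ _ _ _ (@measurable_fst _ _ (borel E) (borel E)).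
pose p : {mfun _ >-> _} := HB.pack (@fst (borel E) (borel E)) mx.
transitivity (\int[pushforward pi p]_x f x).
  by rewrite ge0_integral_pushforward.
apply: eq_measure_integral => A mA _; rewrite /pushforward/=.
have [<- _] := cpi A mA; congr (pi _).
by apply/seteqP; split => -[x y]//= [].
Qed.

Lemma coupling_integral_snd mu nu pi (f : borel E -> \bar R) :
  coupling mu nu pi -> measurable_fun setT f -> (forall x, 0 <= f x) ->
  \int[pi]_z f z.2 = \int[nu]_x f x.
Proof.
move=> cpi mf f0.
pose mx := isMeasurableFun.Build _ _ _ _ _ (@measurable_snd _ _ (borel E) (borel E)).
pose p : {mfun _ >-> _} := HB.pack (@snd (borel E) (borel E)) mx.
transitivity (\int[pushforward pi p]_x f x).
  by rewrite ge0_integral_pushforward.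
apply: eq_measure_integral => A mA _; rewrite /pushforward/=.
have [_ <-] := cpi A mA; congr (pi _).
by apply/seteqP; split => -[x y]//= [].
Qed.

(** The elementary half of Kantorovich duality, in both directions so that no
    integral has to be subtracted. *)
Lemma integral_lipschitz_le_transport mu nu F (M : R) :
  (forall x, 0 <= F x <= M)%R -> (forall x y, F y <= F x + mdist x y)%R ->
  \int[nu]_x (F x)%:E <= \int[mu]_x (F x)%:E + transport_cost mu nu /\
  \int[mu]_x (F x)%:E <= \int[nu]_x (F x)%:E + transport_cost mu nu.
Proof.
move=> FM FL; have F0 x : 0 <= (F x)%:E by rewrite lee_fin; case/andP: (FM x).
have mF : measurable_fun [set: borel E] (EFin \o F).
  by apply/measurable_EFinP; exact: (measurable_lipschitz FL).
have Ffin (m : probability (borel E) R) : \int[m]_x (F x)%:E \is a fin_num.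
  apply: (@integral_bounded_fin_num _ _ _ m F M) => //.
  exact/measurable_EFinP.
have md : measurable_fun [set: borel E * borel E]
    (fun z => (mdist (z.1 : E) (z.2 : E))%:E).
  by apply/measurable_EFinP; exact: measurable_mdist.
have mFst : measurable_fun [set: borel E * borel E] (fun z => (F z.1)%:E).
  by apply: (measurableT_comp mF); exact: measurable_fst.
have mSnd : measurable_fun [set: borel E * borel E] (fun z => (F z.2)%:E).
  by apply: (measurableT_comp mF); exact: measurable_snd.
have d0 (z : borel E * borel E) : 0 <= (mdist (z.1 : E) (z.2 : E))%:E.
  by rewrite lee_fin mdist_ge0.
split.
- rewrite -leeBlDl//; apply: le_ereal_inf_tmp => _ [pi cpi <-].
  rewrite leeBlDl// -(coupling_integral_fst cpi mF F0).
  rewrite -(coupling_integral_snd cpi mF F0) -ge0_integralD//; last first.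
    by move=> z _; exact: F0.
  apply: ge0_le_integral => //=; first exact: emeasurable_funD.
  by move=> z _; rewrite -EFinD lee_fin.
- rewrite -leeBlDl//; apply: le_ereal_inf_tmp => _ [pi cpi <-].
  rewrite leeBlDl// -(coupling_integral_fst cpi mF F0).
  rewrite -(coupling_integral_snd cpi mF F0) -ge0_integralD//; last first.
    by move=> z _; exact: F0.
  apply: ge0_le_integral => //=; first exact: emeasurable_funD.
  by move=> z _; rewrite -EFinD lee_fin metric_sym.
Qed.

End transport_bounds.

Section coupling_of_density.
Local Open Scope ereal_scope.
Context (R : realType) (E : polishMetricType R).
Variables (mu nu : probability (borel E) R) (h : borel E -> R) (x0 : E).
Hypotheses (mh : measurable_fun [set: borel E] h) (h0 : forall x, (0 <= h x)%R).
Hypothesis nuh : has_density nu mu h.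

Let hmin (x : borel E) : R := Num.min (h x) 1%R.
Let hm (x : borel E) : R := Num.max (1 - h x)%R 0%R.
Let hp (x : borel E) : R := Num.max (h x - 1)%R 0%R.

Let hmin_hm x : (hmin x + hm x = 1)%R.
Proof. by rewrite /hmin /hm /Num.min /Num.max; case: ifPn; case: ifPn; lra. Qed.

Let hmin_hp x : (hmin x + hp x = h x)%R.
Proof. by rewrite /hmin /hp /Num.min /Num.max; case: ifPn; case: ifPn; lra. Qed.

Let hm_hp x : (hm x + hp x = `|h x - 1|)%R.
Proof.
by rewrite /hm /hp /Num.max; case: (ler0P (h x - 1)%R); case: ifPn; case: ifPn; lra.
Qed.

Let mhmin : measurable_fun [set: borel E] hmin.
Proof. exact: measurable_minr. Qed.

Let mhm : measurable_fun [set: borel E] hm.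
Proof. by apply: measurable_maxr => //; exact: measurable_funB. Qed.

Let mhp : measurable_fun [set: borel E] hp.
Proof. by apply: measurable_maxr => //; exact: measurable_funB. Qed.

Let hmin0 x : (0 <= hmin x)%R.
Proof. by rewrite le_min h0 ler01. Qed.

Let hm0 x : (0 <= hm x)%R.
Proof. by rewrite le_max lexx orbT. Qed.

Let hp0 x : (0 <= hp x)%R.
Proof. by rewrite le_max lexx orbT. Qed.

Let weighted_integralD (f : borel E -> \bar R) (u v w : borel E -> R) :
  measurable_fun setT f -> (forall x, 0 <= f x) ->
  measurable_fun setT u -> (forall x, 0 <= u x)%R ->
  measurable_fun setT v -> (forall x, 0 <= v x)%R ->
  (forall x, u x + v x = w x)%R ->
  \int[mu]_x (f x * (u x)%:E) + \int[mu]_x (f x * (v x)%:E) =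
  \int[mu]_x (f x * (w x)%:E).
Proof.
move=> mf f0 mu0 u0 mv v0 uvw; rewrite -ge0_integralD//.
- by apply: eq_integral => x _; rewrite -ge0_muleDr ?lee_fin// -EFinD uvw.
- by move=> x _; rewrite mule_ge0// lee_fin.
- by apply: emeasurable_funM => //; exact/measurable_EFinP.
- by move=> x _; rewrite mule_ge0// lee_fin.
- by apply: emeasurable_funM => //; exact/measurable_EFinP.
Qed.

(** The mass min(h,1) mu common to both measures stays in place.  What remains,
    (1-h)^+ mu and (h-1)^+ mu, has the same mass a; it is coupled independently,
    at a cost bounded by going through x0. *)
Lemma transport_cost_le_density :
  transport_cost mu nu <= \int[mu]_x (mdist (x : E) x0 * `|h x - 1|)%R%:E.
Proof.
have nuT : \int[mu]_x (h x)%:E = 1.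
  by rewrite -nuh//; exact: probability_setT.
have one0 (x : borel E) : 0 <= (1 : \bar R) by [].
have mone : measurable_fun [set: borel E] (cst (1 : \bar R)) by [].
have mul1 (u : borel E -> R) :
    \int[mu]_x (u x)%:E = \int[mu]_x (1 * (u x)%:E).
  by apply: eq_integral => x _; rewrite mul1e.
have Imin_m := weighted_integralD mone one0 mhmin hmin0 mhm hm0 hmin_hm.
have Imin_p := weighted_integralD mone one0 mhmin hmin0 mhp hp0 hmin_hp.
rewrite -!mul1 integral_cst_probability in Imin_m.
rewrite -!mul1 nuT in Imin_p.
have fin (u : borel E -> R) v : (forall x, 0 <= u x)%R ->
    \int[mu]_x (u x)%:E + v = 1 -> 0 <= v -> \int[mu]_x (u x)%:E \is a fin_num.
  move=> u0 uv v0; rewrite ge0_fin_numE; last first.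
    by apply: integral_ge0 => x _; rewrite lee_fin.
  by apply: (@le_lt_trans _ _ 1); rewrite ?ltry// -uv leeDl.
have I0 (u : borel E -> R) : (forall x, 0 <= u x)%R -> 0 <= \int[mu]_x (u x)%:E.
  by move=> u0; apply: integral_ge0 => x _; rewrite lee_fin.
have finmin := fin _ _ hmin0 Imin_m (I0 _ hm0).
have := fin _ _ hm0 _ (I0 _ hmin0); rewrite addeC => /(_ Imin_m) finm.
have Ipm : \int[mu]_x (hp x)%:E = \int[mu]_x (hm x)%:E.
  rewrite -[LHS](addeK _ finmin) -[RHS](addeK _ finmin); congr (_ - _).
  by rewrite addeC Imin_p addeC Imin_m.
set b := fine (\int[mu]_x (hmin x)%:E).
set a := fine (\int[mu]_x (hm x)%:E).
have bE : \int[mu]_x (hmin x)%:E = b%:E by rewrite fineK.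
have aE : \int[mu]_x (hm x)%:E = a%:E by rewrite fineK.
have [b0 a0] : (0 <= b)%R /\ (0 <= a)%R by rewrite !fine_ge0 ?I0.
have [P0 P0E] := exists_normalized_density mhmin hmin0 bE.
have [P1 P1E] := exists_normalized_density mhm hm0 aE.
have [P2 P2E] := exists_normalized_density mhp hp0 (etrans Ipm aE).
pose diag (x : borel E) := (x, x).
have mdiag : measurable_fun [set: borel E] diag by exact: measurable_fun_pair.
pose mx := isMeasurableFun.Build _ _ _ _ _ mdiag.
pose dg : {mfun _ >-> _} := HB.pack diag mx.
(* With P0, P1, P2 the normalizations of the three pieces, of masses b, a, a. *)
pose pi0 : {measure set (borel E * borel E) -> \bar R} :=
  measure_add (mscale (NngNum b0) (distribution P0 dg))
  (mscale (NngNum a0) (P1 \x P2)).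
have pi0E A : pi0 A = b%:E * P0 (diag @^-1` A) + a%:E * (P1 \x P2) A.
  exact: measure_addE.
have indE (P : probability (borel E) R) A : measurable A ->
    P A = \int[P]_x (\1_A x)%:E.
  by move=> mA; rewrite integral_indic ?setIT.
have ind0 A (x : borel E) : 0 <= (\1_A x : R)%:E by rewrite lee_fin.
have mind A : measurable A -> measurable_fun [set: borel E] (fun x => (\1_A x : R)%:E).
  by move=> mA; exact/measurable_EFinP/measurable_indic.
have massE (P : probability (borel E) R) c (u : borel E -> R) A :
    (forall f, (forall x, 0 <= f x) -> measurable_fun setT f ->
      c%:E * \int[P]_x f x = \int[mu]_x (f x * (u x)%:E)) -> measurable A ->
    c%:E * P A = \int[mu]_x ((\1_A x)%:E * (u x)%:E).
  by move=> PE mA; rewrite indE// PE//; exact: mind.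
have pfst A : measurable A -> pi0 (A `*` setT) = mu A.
  move=> mA; rewrite pi0E product_measure1E// [X in _ * (_ * X)]probability_setT mule1.
  rewrite (_ : _ @^-1` _ = A); last by apply/seteqP; split => x //= [].
  apply: etrans (congr2 adde (massE _ _ _ _ P0E mA) (massE _ _ _ _ P1E mA)) _.
  apply: etrans (weighted_integralD (mind _ mA) (ind0 A) mhmin hmin0 mhm hm0 hmin_hm) _.
  by rewrite indE//; apply: eq_integral => x _; rewrite mule1.
have psnd A : measurable A -> pi0 (setT `*` A) = nu A.
  move=> mA; rewrite pi0E product_measure1E// [X in _ * (X * _)]probability_setT mul1e.
  rewrite (_ : _ @^-1` _ = A); last by apply/seteqP; split => x //= [].
  apply: etrans (congr2 adde (massE _ _ _ _ P0E mA) (massE _ _ _ _ P2E mA)) _.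
  apply: etrans (weighted_integralD (mind _ mA) (ind0 A) mhmin hmin0 mhp hp0 hmin_hp) _.
  by rewrite indE// (ge0_integral_density mh h0 nuh)//; exact: mind.
have piT : pi0 setT = 1.
  by rewrite -setXTT pfst//; exact: probability_setT.
pose pp := Measure_isProbability.Build _ _ _ pi0 piT.
pose pi : probability (borel E * borel E)%type R := HB.pack (Measure.sort pi0) pp.
have md : measurable_fun [set: borel E * borel E]
    (fun z => (mdist (z.1 : E) (z.2 : E))%:E).
  by apply/measurable_EFinP; exact: measurable_mdist.
have d0 (z : borel E * borel E) : 0 <= (mdist (z.1 : E) (z.2 : E))%:E.
  by rewrite lee_fin mdist_ge0.
pose D (x : borel E) := (mdist (x : E) x0)%:E.
have mD : measurable_fun [set: borel E] D.
  by apply/measurable_EFinP; exact: measurable_mdistr.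
have D0 x : 0 <= D x by rewrite lee_fin mdist_ge0.
apply: (@le_trans _ _ (\int[pi]_z (mdist (z.1 : E) (z.2 : E))%:E)).
  by apply: ereal_inf_lbound; exists pi => // A mA; split; [exact: pfst|exact: psnd].
rewrite (_ : \int[pi]_z _ = \int[pi0]_z (mdist (z.1 : E) (z.2 : E))%:E)//.
rewrite ge0_integral_measure_add// !ge0_integral_mscale//.
rewrite ge0_integral_distribution// [\int[P0]_x _]integral0_eq; last first.
  by move=> x _; congr EFin; exact: mdistxx.
rewrite mule0 add0e fubini_tonelli1//.
have -> : \int[mu]_x (mdist (x : E) x0 * `|h x - 1|)%R%:E =
    a%:E * (\int[P1]_x D x + \int[P2]_x D x).
  rewrite ge0_muleDr ?integral_ge0// P1E// P2E//.
  by rewrite (weighted_integralD mD D0 mhm hm0 mhp hp0 hm_hp).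
apply: lee_wpmul2l; first by rewrite lee_fin.
have cst1 (P : probability (borel E) R) (c : \bar R) : \int[P]_x c = c.
  transitivity (c * P setT); first exact: integral_cst.
  by rewrite probability_setT mule1.
rewrite -[X in _ <= _ + X](cst1 P1) -ge0_integralD//; last first.
  by move=> x _; exact: integral_ge0.
apply: ge0_le_integral => //.
- by move=> x _; exact: integral_ge0.
- exact: measurable_fun_fubini_tonelli_F.
- exact: emeasurable_funD.
move=> x _; rewrite -[X in X + _](cst1 P2) -ge0_integralD//.
apply: ge0_le_integral => //.
- exact: (measurableT_comp md (pair1_measurable x)).
- exact: emeasurable_funD.
- move=> y _; rewrite -EFinD lee_fin/= (metric_sym (y : E)).
  exact: metric_triangle.
Qed.

End coupling_of_density.

(** * Gaussian moments imply T1 *)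

Section cauchy_schwarz.
Local Open Scope ereal_scope.
Context d (T : measurableType d) (R : realType) (mu : {measure set T -> \bar R}).
Implicit Types g k w : T -> R.

Lemma ge0_integral_comb g k (a b : R) : (0 <= a)%R -> (0 <= b)%R ->
  measurable_fun [set: T] g -> (forall x, 0 <= g x)%R ->
  measurable_fun [set: T] k -> (forall x, 0 <= k x)%R ->
  \int[mu]_x (a * g x + b * k x)%:E =
  a%:E * \int[mu]_x (g x)%:E + b%:E * \int[mu]_x (k x)%:E.
Proof.
move=> a0 b0 mg g0 mk k0.
have mEg : measurable_fun [set: T] (EFin \o g) by exact/measurable_EFinP.
have mEk : measurable_fun [set: T] (EFin \o k) by exact/measurable_EFinP.
rewrite -!ge0_integralZl ?lee_fin//; last 2 first.
- by move=> x _; rewrite lee_fin.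
- by move=> x _; rewrite lee_fin.
rewrite -ge0_integralD//.
- by move=> x _; rewrite mule_ge0 ?lee_fin.
- exact: measurable_funeM.
- by move=> x _; rewrite mule_ge0 ?lee_fin.
- exact: measurable_funeM.
Qed.

(** Cauchy-Schwarz for w <= sqrt (g k), by integrating
    w <= (e g + k / e) / 2 and optimizing e. *)
Lemma integral_le_sqrt w g k (Mg Mk : R) :
  measurable_fun [set: T] w -> (forall x, 0 <= w x)%R ->
  measurable_fun [set: T] g -> (forall x, 0 <= g x)%R ->
  measurable_fun [set: T] k -> (forall x, 0 <= k x)%R ->
  (forall x, w x ^+ 2 <= g x * k x)%R ->
  (0 < Mg)%R -> \int[mu]_x (g x)%:E <= Mg%:E ->
  \int[mu]_x (k x)%:E <= Mk%:E ->
  \int[mu]_x (w x)%:E <= (Num.sqrt (Mg * Mk))%:E.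
Proof.
move=> mw w0 mg g0 mk k0 wgk Mg0 gMg kMk.
have Mk0 : (0 <= Mk)%R.
  by rewrite -lee_fin (le_trans _ kMk)// integral_ge0// => x _; rewrite lee_fin.
have wle e : (0 < e)%R -> \int[mu]_x (w x)%:E <= ((e * Mg + Mk / e) / 2)%:E.
  move=> e0; have e20 : (0 <= e / 2)%R by lra.
  have ie0 : (0 <= e^-1 / 2)%R by rewrite divr_ge0// invr_ge0 ltW.
  apply: (@le_trans _ _ (\int[mu]_x (e / 2 * g x + e^-1 / 2 * k x)%:E)).
    apply: ge0_le_integral => //.
    - by move=> x _; rewrite lee_fin.
    - exact/measurable_EFinP.
    - by apply/measurable_EFinP; apply: measurable_funD; exact: measurable_funM.
    move=> x _; rewrite lee_fin -(@ler_pXn2r _ 2)// ?nnegrE//; last first.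
      by rewrite addr_ge0// mulr_ge0.
    apply: (le_trans (wgk x)); rewrite -subr_ge0.
    rewrite (_ : _ - _ = (e / 2 * g x - e^-1 / 2 * k x) ^+ 2)%R ?sqr_ge0//.
    by field; rewrite gt_eqF.
  rewrite ge0_integral_comb//.
  rewrite (_ : (e * Mg + Mk / e) / 2 = e / 2 * Mg + e^-1 / 2 * Mk)%R; last first.
    by field; rewrite gt_eqF.
  by rewrite EFinD !EFinM; apply: leeD; apply: lee_wpmul2l => //; rewrite lee_fin.
have wfin : \int[mu]_x (w x)%:E \is a fin_num.
  rewrite ge0_fin_numE; last by apply: integral_ge0 => x _; rewrite lee_fin.
  exact: le_lt_trans (wle _ ltr01) (ltry _).
rewrite -(fineK wfin) lee_fin; apply: le_sqrt_of_le_mean => // e e0.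
by rewrite -lee_fin fineK//; exact: wle.
Qed.

End cauchy_schwarz.

Section entropy_integral.
Local Open Scope ereal_scope.
Context d (T : measurableType d) (R : realType) (mu nu : probability T R).
Variable h : T -> R.
Hypotheses (mh : measurable_fun [set: T] h) (h0 : forall x, (0 <= h x)%R).
Hypothesis nuh : has_density nu mu h.

Lemma measurable_entropy_fun : measurable_fun [set: T] (fun x => entropy_fun (h x)).
Proof.
apply: measurable_funD => //; apply: measurable_funB => //.
by apply: measurable_funM => //; exact: measurableT_comp (@measurable_ln R) mh.
Qed.

Lemma integral_density1 : \int[mu]_x (h x)%:E = 1.
Proof. by rewrite -nuh//; exact: probability_setT. Qed.

(** Finiteness makes h ln h integrable, its negative part being at most 1; then
    the correction 1 - h integrates to 0. *)
Lemma integral_entropy_fun : rel_entropy nu mu < +oo ->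
  \int[mu]_x (entropy_fun (h x))%:E = rel_entropy nu mu.
Proof.
rewrite (rel_entropy_density mh h0 nuh); set f := fun x => (h x * ln (h x))%:E.
move=> foo.
have mf : measurable_fun [set: T] f.
  apply/measurable_EFinP/measurable_funM => //.
  exact: measurableT_comp (@measurable_ln R) mh.
have negf : \int[mu]_x f^\- x <= 1.
  rewrite -[leRHS](integral_cst_probability mu); apply: ge0_le_integral => //.
    exact: measurable_funeneg.
  move=> x _; rewrite funenegE /f -EFinN -EFin_max lee_fin ge_max ler01 andbT.
  have := entropy_fun_ge0 (h0 x); have := h0 x; rewrite /entropy_fun; lra.
have negfin : \int[mu]_x f^\- x \is a fin_num.
  by rewrite ge0_fin_numE ?integral_ge0// (le_lt_trans negf)// ltry.
have posoo : \int[mu]_x f^\+ x < +oo.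
  rewrite -(subeK (\int[mu]_x f^\+ x) negfin) -integralE lte_add_pinfty//.
  by rewrite -ge0_fin_numE ?integral_ge0.
have fint : mu.-integrable [set: T] f.
  apply/integrableP; split => //.
  under eq_integral do rewrite -/((abse \o f) _) fune_abse.
  rewrite ge0_integralD//; [|exact: measurable_funepos|exact: measurable_funeneg].
  by rewrite lte_add_pinfty// (le_lt_trans negf)// ltry.
have hint : mu.-integrable [set: T] (EFin \o h).
  apply/integrableP; split; first exact/measurable_EFinP.
  under eq_integral do rewrite /= ger0_norm//.
  by rewrite integral_density1 ltry.
have oint : mu.-integrable [set: T] (EFin \o cst 1%R).
  exact: finite_measure_integrable_cst.
rewrite (_ : (fun x => _) = (f \- (EFin \o h)) \+ (EFin \o cst 1%R)); last first.
  by apply/funext => x; rewrite /entropy_fun /f /= EFinD EFinB.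
rewrite integralD//; last exact: integrableB.
rewrite integralB// integral_density1 integral_cst_probability.
by rewrite subeK.
Qed.

End entropy_integral.

Section T1_from_gaussian_moment.
Local Open Scope ereal_scope.
Context (R : realType) (E : polishMetricType R).

Section with_density.
Variables (mu nu : probability (borel E) R) (x0 : E) (h : borel E -> R).
Variables (alpha L H : R).
Hypotheses (alpha0 : (0 < alpha)%R) (L0 : (0 < L)%R).
Hypothesis gauss : \int[mu]_x (expR (alpha * mdist (x : E) x0 ^+ 2))%:E <= (expR L)%:E.
Hypotheses (mh : measurable_fun [set: borel E] h) (h0 : forall x, (0 <= h x)%R).
Hypothesis h1 : \int[mu]_x (h x)%:E = 1.
Hypothesis hH : \int[mu]_x (entropy_fun (h x))%:E <= H%:E.

Let phi (x : borel E) : R := mdist (x : E) x0.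

Let mphi : measurable_fun [set: borel E] phi.
Proof. exact: measurable_mdistr. Qed.

Let mphi2 : measurable_fun [set: borel E] (fun x => phi x ^+ 2)%R.
Proof. exact: measurable_funX. Qed.

Let phi2_0 x : (0 <= phi x ^+ 2)%R. Proof. exact: sqr_ge0. Qed.

(** Integrate the pointwise Gibbs inequality with parameter
    alpha d(x,x0)^2 - L: the shift by L makes the exponential integrate to at
    most 1. *)
Lemma second_moment_density :
  \int[mu]_x (mdist (x : E) x0 ^+ 2 * h x)%:E <= ((H + L) / alpha)%:E.
Proof.
have mexp : measurable_fun [set: borel E] (fun x => expR (alpha * phi x ^+ 2)).
  by apply: measurableT_comp => //; exact: measurable_funM.
have ment := measurable_entropy_fun mh.
have ent0 x : (0 <= entropy_fun (h x))%R by exact: entropy_fun_ge0.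
have mLh : measurable_fun [set: borel E] (fun x => L * h x)%R.
  exact: measurable_funM.
have mphi2h : measurable_fun [set: borel E] (fun x => phi x ^+ 2 * h x)%R.
  exact: measurable_funM.
have phi2h0 x : (0 <= phi x ^+ 2 * h x)%R by rewrite mulr_ge0.
have mentLh : measurable_fun [set: borel E] (fun x => entropy_fun (h x) + L * h x)%R.
  exact: measurable_funD.
have entLh0 x : (0 <= entropy_fun (h x) + L * h x)%R.
  by rewrite addr_ge0// mulr_ge0// ltW.
have : alpha%:E * \int[mu]_x (phi x ^+ 2 * h x)%:E + 1%:E * \int[mu]_x 1%:E <=
   1%:E * \int[mu]_x (entropy_fun (h x) + L * h x)%:E +
   (expR (- L))%:E * \int[mu]_x (expR (alpha * phi x ^+ 2))%:E.
  rewrite -!ge0_integral_comb ?expR_ge0 ?(ltW alpha0)//.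
  apply: ge0_le_integral => //.
  - by move=> x _; rewrite lee_fin addr_ge0// mulr_ge0// ltW.
  - by apply/measurable_EFinP/measurable_funD => //; exact: measurable_funM.
  - by apply/measurable_EFinP/measurable_funD; exact: measurable_funM.
  - move=> x _; rewrite lee_fin !mul1r mulrA.
    have := young_entropy (alpha * phi x ^+ 2 - L) (h0 x).
    by rewrite expRD mulrBl (mulrC (expR (alpha * _))) => ?; lra.
have -> : \int[mu]_x (entropy_fun (h x) + L * h x)%:E =
    \int[mu]_x (entropy_fun (h x))%:E + L%:E.
  transitivity (\int[mu]_x (1 * entropy_fun (h x) + L * h x)%:E).
    by apply: eq_integral => x _; rewrite mul1r.
  by rewrite ge0_integral_comb ?(ltW L0)// h1 mule1 mul1e.
rewrite integral_cst_probability !mul1e => le1.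
have : alpha%:E * \int[mu]_x (phi x ^+ 2 * h x)%:E + 1 <= H%:E + L%:E + 1.
  apply: (le_trans le1); apply: leeD; first exact: leeD2r.
  apply: (le_trans (lee_wpmul2l _ gauss)); first by rewrite lee_fin expR_ge0.
  by rewrite -EFinM -expRD addNr expR0.
rewrite leeD2rE// -EFinD muleC -lee_pdivlMr//.
Qed.

End with_density.

Variables (mu : probability (borel E) R) (x0 : E) (alpha L : R).
Hypotheses (alpha0 : (0 < alpha)%R) (L0 : (0 < L)%R).
Hypothesis gauss : \int[mu]_x (expR (alpha * mdist (x : E) x0 ^+ 2))%:E <= (expR L)%:E.

(** The case h = 1, where the entropy is 0: Jensen's inequality. *)
Lemma second_moment : \int[mu]_x (mdist (x : E) x0 ^+ 2)%:E <= (L / alpha)%:E.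
Proof.
pose one (x : borel E) : R := 1%R.
have one1 : \int[mu]_x (one x)%:E = 1 by exact: integral_cst_probability.
have oneH : \int[mu]_x (entropy_fun (one x))%:E <= 0%:E.
  by rewrite integral0_eq// => x _; rewrite /entropy_fun ln1 mulr0 sub0r addNr.
have one0 x : (0 <= one x)%R by exact: ler01.
have mone : measurable_fun [set: borel E] one by exact: measurable_cst.
have := second_moment_density alpha0 L0 gauss mone one0 one1 oneH.
by rewrite add0r; under eq_integral do rewrite /one mulr1.
Qed.

(** Cauchy-Schwarz is applied with two different factorizations.  For small H,
    the pointwise Pinsker inequality gives
    (int d |h-1| dmu)^2 <= (2L + 2H/3) H / alpha, which is good enough up to
    H = 3.  For large H the crude bound |h-1| <= 1 + h gives
    2 (H + 2L) / alpha, which is good enough from H = 2 on. *)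
Lemma transport_cost_le_of_gaussian (nu : probability (borel E) R) (h : borel E -> R)
    (H : R) :
  measurable_fun [set: borel E] h -> (forall x, (0 <= h x)%R) ->
  has_density nu mu h -> \int[mu]_x (entropy_fun (h x))%:E <= H%:E ->
  transport_cost mu nu <= (Num.sqrt (2 * ((1 + L) / alpha) * H))%:E.
Proof.
move=> mh h0 nuh hH; have h1 := integral_density1 nuh.
have A := second_moment.
have B := second_moment_density alpha0 L0 gauss mh h0 h1 hH.
pose phi (x : borel E) : R := mdist (x : E) x0.
have mphi : measurable_fun [set: borel E] phi by exact: measurable_mdistr.
have mphi2 : measurable_fun [set: borel E] (fun x => phi x ^+ 2)%R.
  exact: measurable_funX.
have mphi2h : measurable_fun [set: borel E] (fun x => phi x ^+ 2 * h x)%R.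
  exact: measurable_funM.
have phi2_0 x : (0 <= phi x ^+ 2)%R by exact: sqr_ge0.
have phi2h0 x : (0 <= phi x ^+ 2 * h x)%R by rewrite mulr_ge0.
have mw : measurable_fun [set: borel E] (fun x => phi x * `|h x - 1|)%R.
  apply: measurable_funM => //; apply: measurableT_comp => //.
  exact: measurable_funB.
have w0 x : (0 <= phi x * `|h x - 1|)%R by rewrite mulr_ge0// mdist_ge0.
have H0 : (0 <= H)%R.
  rewrite -lee_fin (le_trans _ hH)// integral_ge0// => x _.
  by rewrite lee_fin entropy_fun_ge0.
have comb (a b : R) : (0 <= a)%R -> (0 <= b)%R ->
    \int[mu]_x (a * phi x ^+ 2 + b * (phi x ^+ 2 * h x))%:E <=
    (a * (L / alpha) + b * ((H + L) / alpha))%:E.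
  move=> a0 b0; rewrite ge0_integral_comb// EFinD !EFinM.
  by apply: leeD; apply: lee_wpmul2l => //; rewrite lee_fin.
have mcomb (a b : R) : measurable_fun [set: borel E]
    (fun x => a * phi x ^+ 2 + b * (phi x ^+ 2 * h x))%R.
  by apply: measurable_funD; exact: measurable_funM.
have tH (M b : R) : (M * b <= 2 * ((1 + L) / alpha) * H)%R ->
    (Num.sqrt (M * b))%:E <= (Num.sqrt (2 * ((1 + L) / alpha) * H))%:E.
  by move=> Mb; rewrite lee_fin ler_wsqrtr.
have comb0 (a b : R) x : (0 <= a)%R -> (0 <= b)%R ->
    (0 <= a * phi x ^+ 2 + b * (phi x ^+ 2 * h x))%R.
  by move=> a0 b0; rewrite addr_ge0// mulr_ge0.
have La : (0 < L / alpha)%R by rewrite divr_gt0.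
have HLa : (0 <= (H + L) / alpha)%R by rewrite divr_ge0 ?addr_ge0 ?(ltW L0) ?(ltW alpha0).
apply: (le_trans (transport_cost_le_density x0 mh h0 nuh)).
(* Any threshold between 2 and 3 would do. *)
have [H2|H2] := leP H 2%R.
- have c0 : (0 <= 4 / 3 :> R)%R by lra.
  have c1 : (0 <= 2 / 3 :> R)%R by lra.
  have M0 : (0 < 4 / 3 * (L / alpha) + 2 / 3 * ((H + L) / alpha))%R.
    by apply: ltr_pwDl; [apply: mulr_gt0 => //; lra|exact: mulr_ge0].
  apply: (le_trans (integral_le_sqrt mw w0 (mcomb _ _)
    (fun x => comb0 _ _ x c0 c1) (measurable_entropy_fun mh)
    (fun x => entropy_fun_ge0 (h0 x)) _ M0 (comb _ _ c0 c1) hH)).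
  + move=> x; have := sqr_sub1_le_entropy (h0 x) => /(ler_wpM2l (phi2_0 x)).
    rewrite exprMn -normrX ger0_norm ?sqr_ge0//; lra.
  + apply: tH; rewrite -subr_ge0.
    rewrite (_ : _ - _ = 2 / 3 * (3 - H) * (H / alpha))%R; last by field; rewrite gt_eqF.
    by rewrite mulr_ge0 ?divr_ge0 ?(ltW alpha0)//; lra.
- have M0 : (0 < 1 * (L / alpha) + 1 * ((H + L) / alpha))%R.
    by apply: ltr_pwDl; [exact: mulr_gt0|exact: mulr_ge0].
  have mh1 : measurable_fun [set: borel E] (fun x => 1 * 1 + 1 * h x)%R.
    by apply: measurable_funD => //; exact: measurable_funM.
  have h10 x : (0 <= 1 * 1 + 1 * h x)%R by rewrite addr_ge0// mul1r.
  have Ih1 : \int[mu]_x (1 * 1 + 1 * h x)%:E <= 2%:E.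
    rewrite ge0_integral_comb// h1 integral_cst_probability -!EFinM -EFinD.
    by rewrite lee_fin; lra.
  apply: (le_trans (integral_le_sqrt mw w0 (mcomb _ _)
    (fun x => comb0 _ _ x ler01 ler01) mh1 h10 _ M0 (comb _ _ ler01 ler01) Ih1)).
  + move=> x; have : ((h x - 1) ^+ 2 <= (1 + h x) ^+ 2)%R by have := h0 x; nra.
    move=> /(ler_wpM2l (phi2_0 x)).
    rewrite exprMn -normrX ger0_norm ?sqr_ge0//; lra.
  + apply: tH; rewrite -subr_ge0.
    rewrite (_ : _ - _ = 2 * (L * (H - 2)) / alpha)%R; last by field; rewrite gt_eqF.
    by rewrite divr_ge0 ?(ltW alpha0)// !mulr_ge0 ?(ltW L0)// subr_ge0 ltW.
Qed.

Lemma T1_ineq_of_gaussian : T1_ineq mu ((1 + L) / alpha).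
Proof.
have C0 : (0 < (1 + L) / alpha)%R by rewrite divr_gt0// addr_gt0.
split=> // nu.
have [Hoo|] := eqVneq (rel_entropy nu mu) +oo.
  by rewrite Hoo gt0_muley ?leey// lte_fin mulr_gt0.
rewrite -ltey => Hoo.
have numu : nu `<< mu.
  by move: Hoo; rewrite /rel_entropy; case: ifPn => [/asboolP//|]; rewrite ltxx.
have [h [mh h0 nuh]] := exists_density numu.
have HE := integral_entropy_fun mh h0 nuh Hoo.
have Hfin : rel_entropy nu mu \is a fin_num.
  rewrite ge0_fin_numE// -HE integral_ge0// => x _.
  by rewrite lee_fin entropy_fun_ge0.
have HEle : \int[mu]_x (entropy_fun (h x))%:E <= (fine (rel_entropy nu mu))%:E.
  by rewrite HE fineK.
apply: (le_trans (transport_cost_le_of_gaussian mh h0 nuh HEle)).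
move: Hfin; case: (rel_entropy nu mu) => [r _| |]//=.
Qed.

End T1_from_gaussian_moment.

(** * T1 implies Gaussian moments *)

Section laplace_transform.
Local Open Scope ereal_scope.
Context (R : realType) (E : polishMetricType R).
Variables (mu : probability (borel E) R) (C M : R) (F : borel E -> R).
Hypothesis T1 : T1_ineq mu C.
Hypothesis F0M : forall x, (0 <= F x <= M)%R.
Hypothesis FL : forall x y : E, (F y <= F x + mdist x y)%R.

Let mF : measurable_fun [set: borel E] F.
Proof. exact: (measurable_lipschitz FL). Qed.

(** Let nu = exp(s F)/z dmu.  Its entropy is H = s int F dnu - ln z, while T1
    gives s (int F dnu - int F dmu) <= |s| sqrt (2 C H) <= C s^2/2 + H.  The
    terms in nu cancel, leaving ln z <= s int F dmu + C s^2/2. *)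
Lemma T1_laplace (s : R) :
  \int[mu]_x (expR (s * F x))%:E <=
  (expR (s * fine (\int[mu]_x (F x)%:E) + C * s ^+ 2 / 2))%:E.
Proof.
have [C0 T1E] := T1.
have mexp : measurable_fun [set: borel E] (fun x => expR (s * F x)).
  by apply: measurableT_comp => //; exact: measurable_funM.
have expK x : (expR (- `|s * M|) <= expR (s * F x) <= expR `|s * M|)%R.
  rewrite !ler_expR -ler_norml !normrM ler_wpM2l//.
  by have /andP[F0 FM] := F0M x; rewrite !ger0_norm// (le_trans F0).
have exp0K x : (0 <= expR (s * F x) <= expR `|s * M|)%R.
  by rewrite expR_ge0; case/andP: (expK x).
have zfin := integral_bounded_fin_num mu mexp exp0K.
set Z := \int[mu]_x (expR (s * F x))%:E in zfin *; pose z := fine Z.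
have zE : Z = z%:E by rewrite fineK.
have z0 : (0 < z)%R.
  rewrite -lte_fin -zE (@lt_le_trans _ _ (expR (- `|s * M|))%:E)//.
    by rewrite lte_fin expR_gt0.
  rewrite -(integral_cst_probability mu); apply: ge0_le_integral => //.
    exact/measurable_EFinP.
  by move=> x _; rewrite lee_fin; case/andP: (expK x).
pose h x : R := (expR (s * F x) / z)%R.
have h0 x : (0 <= h x)%R by rewrite divr_ge0 ?expR_ge0 ?ltW.
have mh : measurable_fun [set: borel E] h by exact: measurable_funM.
have h1 : \int[mu]_x (h x)%:E = 1.
  have mEexp : measurable_fun [set: borel E] (fun x => (expR (s * F x))%:E).
    exact/measurable_EFinP.
  have Eexp0 x : 0 <= (expR (s * F x))%:E by rewrite lee_fin expR_ge0.
  under eq_integral do rewrite EFinM.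
  by rewrite ge0_integralZr ?lee_fin ?invr_ge0 ?(ltW z0)// -/Z zE -EFinM mulfV ?gt_eqF.
have [nu nuh] := exists_probability_density mh h0 h1.
have mEF : measurable_fun [set: borel E] (EFin \o F) by exact/measurable_EFinP.
have EF0 x : 0 <= (F x)%:E by rewrite lee_fin; case/andP: (F0M x).
have FE (P : probability (borel E) R) : \int[P]_x (F x)%:E =
    (fine (\int[P]_x (F x)%:E))%:E.
  by rewrite fineK//; exact: integral_bounded_fin_num F0M.
have nuF := ge0_integral_density mh h0 nuh EF0 mEF.
set m := fine (\int[mu]_x (F x)%:E).
pose n := fine (\int[nu]_x (F x)%:E).
have HE : rel_entropy nu mu = (s * n - ln z)%:E.
  rewrite (rel_entropy_density mh h0 nuh).
  have Fhint : mu.-integrable [set: borel E] (fun x => (F x)%:E * (h x)%:E).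
    apply/integrableP; split.
      by apply: emeasurable_funM => //; exact/measurable_EFinP.
    have Fh0 x : 0 <= (F x)%:E * (h x)%:E by rewrite mule_ge0// lee_fin.
    under eq_integral do rewrite gee0_abs//.
    by rewrite -nuF FE ltry.
  have hint : mu.-integrable [set: borel E] (EFin \o h).
    apply/integrableP; split; first exact/measurable_EFinP.
    by under eq_integral do rewrite /= ger0_norm//; rewrite h1 ltry.
  transitivity (\int[mu]_x (s%:E * ((F x)%:E * (h x)%:E) + (- ln z)%:E * (h x)%:E)).
    apply: eq_integral => x _; rewrite -!EFinM -EFinD; congr EFin.
    rewrite {2}/h ln_div ?posrE ?expR_gt0// expRK; ring.
  rewrite integralD//; [|exact: integrableZl..].
  rewrite !integralZl// -nuF h1 mule1 FE -EFinM -EFinD//.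
have H0 : (0 <= s * n - ln z)%R.
  rewrite -lee_fin -HE -(integral_entropy_fun mh h0 nuh) ?HE ?ltry//.
  by apply: integral_ge0 => x _; rewrite lee_fin entropy_fun_ge0.
set H := (s * n - ln z)%R in HE H0.
have := T1E nu; rewrite HE -EFinM /= => tle.
have [nm mn] := integral_lipschitz_le_transport mu nu F0M FL.
have {}nm : (n <= m + Num.sqrt (2 * C * H))%R.
  by rewrite -lee_fin -FE EFinD -FE (le_trans nm)// leeD2l.
have {}mn : (m <= n + Num.sqrt (2 * C * H))%R.
  by rewrite -lee_fin -FE EFinD -FE (le_trans mn)// leeD2l.
have CH0 : (0 <= 2 * C * H)%R by rewrite mulr_ge0// mulr_ge0// ltW.
have snm : (s * (n - m) <= `|s| * Num.sqrt (2 * C * H))%R.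
  rewrite (le_trans (ler_norm _))// normrM ler_wpM2l// ler_norml.
  by rewrite lerBrDr lerBlDr addrC; apply/andP; split; lra.
have amgm : (`|s| * Num.sqrt (2 * C * H) <= C * s ^+ 2 / 2 + H)%R.
  have B0 : (0 <= C * s ^+ 2 / 2 + H)%R.
    by rewrite addr_ge0// divr_ge0// mulr_ge0 ?sqr_ge0// ltW.
  rewrite -(@ler_pXn2r _ 2)// ?nnegrE ?mulr_ge0// exprMn sqr_sqrtr//.
  rewrite real_normK ?num_real//.
  rewrite -subr_ge0 (_ : _ - _ = (C * s ^+ 2 / 2 - H) ^+ 2)%R ?sqr_ge0//; by field.
rewrite zE lee_fin -(lnK (x := z)) ?posrE// ler_expR.
by move: snm amgm; rewrite /H; lra.
Qed.

End laplace_transform.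

Section gaussian_linearization.
Local Open Scope ereal_scope.
Context {R : realType}.

Lemma normal_pdf_tilt (a b x : R) : (0 < b)%R ->
  (expR (a * x + (1 - b) * x ^+ 2 / 2) * normal_pdf 0 1 x =
   expR (a ^+ 2 / (2 * b)) / Num.sqrt b * normal_pdf (a / b) (Num.sqrt b)^-1 x)%R.
Proof.
move=> b0; have sb0 : (0 < Num.sqrt b)%R by rewrite sqrtr_gt0.
rewrite !normal_pdfE ?oner_neq0 ?invr_neq0 ?gt_eqF// /normal_peak /normal_fun.
rewrite expr1n mul1r exprVn sqr_sqrtr ?(ltW b0)//.
have -> : (Num.sqrt (b^-1 * pi *+ 2) = (Num.sqrt b)^-1 * Num.sqrt (pi *+ 2) :> R)%R.
  by rewrite -mulrnAr sqrtrM ?invr_ge0 ?(ltW b0)// sqrtrV ?ltW.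
have tilt (u v p q sb K : R) : (0 < sb)%R -> (u + p = v + q)%R ->
    (expR u * (K^-1 * expR p) = expR v / sb * ((sb^-1 * K)^-1 * expR q))%R.
  move=> sb_gt0 uvpq; rewrite invfM invrK -!mulrA mulKf ?gt_eqF// mulrCA.
  by rewrite [RHS]mulrCA -!expRD uvpq.
apply: tilt => //; rewrite subr0 !mulr2n.
by field; rewrite gt_eqF.
Qed.

(** Completing the square: the integrand against the standard Gaussian is a
    multiple of the density of mean a/b and variance 1/b. *)
Lemma integral_normal_exp (a b : R) : (0 < b)%R ->
  \int[normal_prob 0 1]_x (expR (a * x + (1 - b) * x ^+ 2 / 2))%:E =
  (expR (a ^+ 2 / (2 * b)) / Num.sqrt b)%:E.
Proof.
move=> b0.
have npd : has_density (normal_prob (0:R) 1) lebesgue_measure (normal_pdf 0 1) by [].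
rewrite (@ge0_integral_density _ _ R lebesgue_measure (normal_prob 0 1)
  (normal_pdf 0 1))//; last 3 first.
- exact: measurable_normal_pdf.
- exact: normal_pdf_ge0.
- apply/measurable_EFinP; apply: measurableT_comp => //.
  by apply: measurable_funD => //; do !apply: measurable_funM => //.
under eq_integral do rewrite -EFinM normal_pdf_tilt// EFinM.
rewrite ge0_integralZl ?lee_fin ?divr_ge0 ?expR_ge0 ?sqrtr_ge0//.
- by rewrite integral_normal_pdf mule1.
- by apply/measurable_EFinP; exact: measurable_normal_pdf.
- by move=> x _; rewrite lee_fin normal_pdf_ge0.
Qed.

(** For a standard Gaussian g, exp(alpha y^2) is the mean of
    exp(sqrt (2 alpha) y g).  Exchanging the integrals linearizes the square in
    the exponent, so that the Laplace bound applies for each g; the resulting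
    Gaussian integral in g converges because 2 C alpha < 1. *)
Lemma integral_exp_sqr_le d (T : measurableType d) (P : probability T R)
    (F : T -> R) (m C alpha : R) :
  measurable_fun [set: T] F -> (0 < alpha)%R -> (2 * C * alpha < 1)%R ->
  (forall s, \int[P]_x (expR (s * F x))%:E <= (expR (s * m + C * s ^+ 2 / 2))%:E) ->
  \int[P]_x (expR (alpha * F x ^+ 2))%:E <=
  (expR (alpha * m ^+ 2 / (1 - 2 * C * alpha)) / Num.sqrt (1 - 2 * C * alpha))%:E.
Proof.
move=> mF alpha0 Ca1 PF; set b := (1 - 2 * C * alpha)%R.
have b0 : (0 < b)%R by rewrite subr_gt0.
pose r := Num.sqrt (2 * alpha); have rE : (r ^+ 2 = 2 * alpha)%R.
  by rewrite sqr_sqrtr// mulr_ge0// ltW.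
pose f (z : T * R) : \bar R := (expR (r * F z.1 * z.2))%:E.
have mf : measurable_fun [set: T * R] f.
  apply/measurable_EFinP; apply: measurableT_comp => //; apply: measurable_funM => //.
  by apply: measurable_funM => //; exact: measurableT_comp mF measurable_fst.
have f0 z : 0 <= f z by rewrite lee_fin expR_ge0.
have -> : \int[P]_x (expR (alpha * F x ^+ 2))%:E =
    \int[P]_x \int[normal_prob 0 1]_g f (x, g).
  apply: eq_integral => x _.
  have := integral_normal_exp (r * F x) ltr01.
  rewrite exprMn rE sqrtr1 divr1 mulr1 => H.
  rewrite (_ : alpha * _ = 2 * alpha * F x ^+ 2 / 2)%R -?H; last by field.
  by apply: eq_integral => g _; rewrite /f/= subrr mul0r mul0r addr0.
rewrite (@fubini_tonelli _ _ _ _ _ P (normal_prob 0 1) f)//.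
apply: (@le_trans _ _ (\int[normal_prob 0 1]_g
    (expR (r * m * g + (1 - b) * g ^+ 2 / 2))%:E)); last first.
  rewrite integral_normal_exp// exprMn rE lee_fin.
  by rewrite (_ : 2 * alpha * m ^+ 2 / _ = alpha * m ^+ 2 / b)%R//; field; rewrite gt_eqF.
apply: ge0_le_integral => //.
- by move=> g _; exact: integral_ge0.
- exact: (@measurable_fun_fubini_tonelli_G _ _ _ _ _ P f mf f0).
- apply/measurable_EFinP; apply: measurableT_comp => //.
  by apply: measurable_funD => //; do !apply: measurable_funM => //.
- move=> g _; under eq_integral do rewrite /f/= mulrAC.
  apply: (le_trans (PF _)); rewrite lee_fin ler_expR exprMn rE /b.
  by rewrite le_eqVlt; apply/orP; left; apply/eqP; field.
Qed.

End gaussian_linearization.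

Section truncation.
Local Open Scope ereal_scope.

Lemma integral_le_of_eventually d (T : measurableType d) (R : realType)
    (P : {measure set T -> \bar R}) (f : nat -> T -> R) (g : T -> R) K :
  (forall n, measurable_fun [set: T] (f n)) ->
  (forall n x, 0 <= f n x)%R ->
  (forall x, {homo f^~ x : a b / (a <= b)%N >-> (a <= b)%R}) ->
  (forall x, exists N, forall n, (N <= n)%N -> f n x = g x) ->
  (forall n, \int[P]_x (f n x)%:E <= K) -> \int[P]_x (g x)%:E <= K.
Proof.
move=> mf f0 ndf fg fK.
have flim x : (f n x)%:E @[n --> \oo] --> (g x)%:E.
  have [N fgN] := fg x.
  apply: cvg_near_cst; exists N => //= n Nn.
  by rewrite fgN.
rewrite (_ : \int[P]_x (g x)%:E = limn (fun n => \int[P]_x (f n x)%:E)); last first.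
  rewrite -monotone_convergence//.
  - by apply: eq_integral => x _; apply/esym/cvg_lim.
  - by move=> n; exact/measurable_EFinP.
  - by move=> n x _; rewrite lee_fin.
  - by move=> x _ a b ab; rewrite lee_fin ndf.
apply: lime_le; last exact: nearW.
apply: ereal_nondecreasing_is_cvgn => a b ab; apply: ge0_le_integral => //.
- by move=> x _; rewrite lee_fin.
- exact/measurable_EFinP.
- exact/measurable_EFinP.
- by move=> x _; rewrite lee_fin ndf.
Qed.

End truncation.

Section gaussian_moment_of_T1.
Local Open Scope ereal_scope.
Context (R : realType) (E : polishMetricType R).
Variables (P : probability (borel E) R) (x0 : E).

(** The distance is truncated at n, since the Laplace bound concerns bounded
    functions; the mean of the truncation is at most the mean distance. *)
Lemma gaussian_moment_of_T1 (C C' s : R) : (0 < C)%R -> (0 < s)%R ->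
  T1_ineq P C' -> (C' <= C)%R ->
  \int[P]_x (expR ((s ^+ 2 + 4 * C)^-1 * mdist (x : E) x0 ^+ 2))%:E <=
  (Num.sqrt 2)%:E * expeR (mean_dist P x0 ^+ 2 / (s ^+ 2)%:E).
Proof.
move=> C0 s0 T1 C'C; set alpha := ((s ^+ 2 + 4 * C)^-1)%R.
have s20 : (0 < s ^+ 2)%R by rewrite exprn_gt0.
have a0 : (0 < alpha)%R by rewrite invr_gt0; lra.
pose F n (x : borel E) : R := Num.min (mdist (x : E) x0) n%:R.
have F0M n x : (0 <= F n x <= n%:R)%R.
  by rewrite le_min mdist_ge0 ler0n ge_min lexx orbT.
have FL n (x y : E) : (F n y <= F n x + mdist x y)%R.
  have := metric_triangle y x x0; rewrite (metric_sym y x) /F /Num.min.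
  have := mdist_ge0 x y.
  by case: ifPn => H1; case: ifPn => H2; move: H1 H2; rewrite -?leNgt; lra.
have mF n : measurable_fun [set: borel E] (F n).
  exact: (measurable_lipschitz (FL n)).
have mD : measurable_fun [set: borel E] (fun x => (mdist (x : E) x0)%:E).
  by apply/measurable_EFinP; exact: measurable_mdistr.
apply: (@integral_le_of_eventually _ _ _ _ (fun n x => expR (alpha * F n x ^+ 2))).
- move=> n; apply: measurableT_comp => //.
  by apply: measurable_funM => //; exact: measurable_funX.
- by move=> n x; exact: expR_ge0.
- move=> x a b ab; rewrite ler_expR ler_wpM2l ?(ltW a0)//.
  rewrite ler_sqr ?nnegrE; [|by case/andP: (F0M a x)|by case/andP: (F0M b x)].
  rewrite /F le_min ge_min lexx/= ge_min; apply/orP; right.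
  by rewrite ler_nat.
- move=> x; exists (Num.truncn (mdist (x : E) x0)).+1 => n dn.
  congr (expR (_ * _ ^+ 2)); apply/min_idPl.
  apply: le_trans (ltW (truncnS_gt _)) _; by rewrite ler_nat.
move=> n; set m := fine (\int[P]_x (F n x)%:E).
have mE : m%:E = \int[P]_x (F n x)%:E.
  by rewrite fineK//; apply: integral_bounded_fin_num (F0M n).
have [Ca1 le1] := sharp_parameters m C0 s0 C'C.
apply: (le_trans (integral_exp_sqr_le (mF n) a0 Ca1 (T1_laplace T1 (F0M n) (FL n)))).
apply: (@le_trans _ _ (Num.sqrt 2 * expR (m ^+ 2 / s ^+ 2))%:E).
  by rewrite lee_fin.
rewrite EFinM lee_wpmul2l ?lee_fin ?sqrtr_ge0//.
rewrite -[leLHS]/(expeR (m ^+ 2 / s ^+ 2)%:E) lee_expeR.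
have m0 : (0 <= m)%R.
  by rewrite -lee_fin mE integral_ge0// => x _; rewrite lee_fin; case/andP: (F0M n x).
have mB : m%:E <= mean_dist P x0.
  rewrite mE; apply: ge0_le_integral => //.
  - by move=> x _; rewrite lee_fin; case/andP: (F0M n x).
  - exact/measurable_EFinP.
  - by move=> x _; rewrite lee_fin ge_min lexx.
rewrite inver gt_eqF//.
case: (mean_dist P x0) mB => [B| |]//; last first.
  by rewrite expe2 mulyy gt0_mulye ?leey// lte_fin invr_gt0.
rewrite lee_fin => mB; rewrite -EFin_expe -EFinM lee_fin ler_wpM2r ?invr_ge0 ?(ltW s20)//.
by rewrite ler_sqr ?nnegrE ?(le_trans m0).
Qed.

End gaussian_moment_of_T1.

(** * Mixtures *)

Section mixture_T1.
Local Open Scope ereal_scope.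
Context (R : realType) (E : polishMetricType R).
Context (d : measure_display) (Theta : measurableType d) (m : probability Theta R).
Variable mu : Theta -> probability (borel E) R.
Hypothesis mmu : forall A : set (borel E), measurable A ->
  measurable_fun [set: Theta] (fun t => mu t A).

Lemma ge0_integral_mixture (f : borel E -> \bar R) : (forall x, 0 <= f x) ->
  measurable_fun [set: borel E] f ->
  \int[mixture m mmu]_x f x = \int[m]_t \int[mu t]_x f x.
Proof. by move=> f0 mf; rewrite (@ge0_integral_bind _ _ _ _ _ m mu). Qed.

Lemma T1_const_ge0 (P : probability (borel E) R) : 0 <= T1_const P.
Proof.
by apply: le_ereal_inf_tmp => _ [C [C0 _] <-]; rewrite lee_fin ltW.
Qed.

Lemma unif_T1_const_ge0 : 0 <= unif_T1_const mu.
Proof.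
apply: le_trans (T1_const_ge0 (mu point)) _.
by apply: ereal_sup_ubound; exists point.
Qed.

Lemma exists_T1_ineq_of_unif (C : R) (t : Theta) : unif_T1_const mu < C%:E ->
  exists2 C', T1_ineq (mu t) C' & (C' <= C)%R.
Proof.
move=> hC; have : T1_const (mu t) < C%:E.
  by apply: le_lt_trans hC; apply: ereal_sup_ubound; exists t.
move=> /ereal_inf_lt[_ [C' TC' <-]]; rewrite lte_fin => /ltW C'C.
by exists C'.
Qed.

(** Integrating gaussian_moment_of_T1 over t, the admissibility of s bounds the
    Gaussian moment of the mixture by 2 sqrt 2 = exp(3/2 ln 2). *)
Lemma mixture_T1_ineq (x0 : E) (C s : R) : (0 < C)%R -> unif_T1_const mu < C%:E ->
  (0 < s)%R ->
  \int[m]_t expeR (mean_dist (mu t) x0 ^+ 2 / (s ^+ 2)%:E) <= 2%:E ->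
  T1_ineq (mixture m mmu) ((s ^+ 2 + 4 * C) * (1 + 3 / 2 * ln 2))%R.
Proof.
move=> C0 hC s0 hs; have s20 : (0 < s ^+ 2)%R by rewrite exprn_gt0.
have D0 : (0 < s ^+ 2 + 4 * C)%R by lra.
have ln20 : (0 < ln (2 : R))%R by rewrite ln_gt0// ltr1n.
have L0 : (0 < 3 / 2 * ln (2 : R))%R by lra.
set alpha := ((s ^+ 2 + 4 * C)^-1)%R.
have a0 : (0 < alpha)%R by rewrite invr_gt0.
have -> : ((s ^+ 2 + 4 * C) * (1 + 3 / 2 * ln 2) = (1 + 3 / 2 * ln 2) / alpha)%R.
  by rewrite /alpha invrK mulrC.
apply: (@T1_ineq_of_gaussian R E _ x0) => //.
have eL : (expR (3 / 2 * ln 2) = Num.sqrt 2 * 2 :> R)%R.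
  rewrite (_ : 3 / 2 * ln 2 = ln 2 / 2 + ln 2)%R; last by field.
  rewrite expRD lnK ?posrE//; congr (_ * _)%R.
  apply/eqP; rewrite -(@eqrXn2 _ 2) ?expR_ge0 ?sqrtr_ge0//.
  by rewrite sqr_sqrtr// -expRM_natr divfK// lnK ?posrE.
have mexp : measurable_fun [set: borel E]
    (fun x => (expR (alpha * mdist (x : E) x0 ^+ 2))%:E).
  apply/measurable_EFinP; apply: measurableT_comp => //.
  by apply: measurable_funM => //; apply: measurable_funX; exact: measurable_mdistr.
have exp0 (x : borel E) : 0 <= (expR (alpha * mdist (x : E) x0 ^+ 2))%:E.
  by rewrite lee_fin expR_ge0.
have mmean : measurable_fun [set: Theta] (fun t => mean_dist (mu t) x0).
  apply: (measurable_fun_integral_kernel mmu).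
    by move=> x; rewrite lee_fin mdist_ge0.
  by apply/measurable_EFinP; exact: measurable_mdistr.
have mexpe : measurable_fun [set: Theta]
    (fun t => expeR (mean_dist (mu t) x0 ^+ 2 / (s ^+ 2)%:E)).
  apply: measurableT_comp (@measurable_expeR R) _.
  apply: emeasurable_funM => //; under eq_fun do rewrite expe2.
  exact: emeasurable_funM.
rewrite ge0_integral_mixture// eL EFinM.
apply: (@le_trans _ _ (\int[m]_t ((Num.sqrt 2)%:E *
    expeR (mean_dist (mu t) x0 ^+ 2 / (s ^+ 2)%:E)))).
  apply: ge0_le_integral => //.
  - by move=> t _; exact: integral_ge0.
  - exact: (measurable_fun_integral_kernel mmu).
  - exact: measurable_funeM.
  - move=> t _; have [C' TC' C'C] := exists_T1_ineq_of_unif t hC.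
    exact: (gaussian_moment_of_T1 x0 C0 s0 TC' C'C).
rewrite ge0_integralZl//.
- by rewrite lee_wpmul2l ?lee_fin ?sqrtr_ge0.
- by move=> t _; exact: expeR_ge0.
Qed.

Lemma mean_dist_psi2_ge0 (x0 : E) : 0 <= mean_dist_psi2 m mu x0.
Proof.
by apply: le_ereal_inf_tmp => _ [s [s0 _] <-]; rewrite lee_fin ltW.
Qed.

End mixture_T1.

(** A quantitative passage to the limit: e = min(1, eps/((2n+5)K+1)) absorbs an
    error eps, as (n+e)^2 - n^2 + 4e <= (2n+5)e for e <= 1. *)
Lemma le_of_sqr_perturbation (R : realFieldType) (n c K r : R) :
  0 <= n -> 0 <= K ->
  (forall e, 0 < e -> exists2 s, 0 < s < n + e & r <= (s ^+ 2 + 4 * (c + e)) * K) ->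
  r <= (n ^+ 2 + 4 * c) * K.
Proof.
move=> n0 K0 H; apply/ler_addgt0Pr => e e0.
have D0 : 0 < (2 * n + 5) * K + 1 by rewrite ltr_wpDl// mulr_ge0// addr_ge0// mulr_ge0.
pose a := Num.min 1 (e / ((2 * n + 5) * K + 1)).
have a0 : 0 < a by rewrite lt_min ltr01 divr_gt0.
have a1 : a <= 1 by rewrite ge_min lexx.
have ae : a * ((2 * n + 5) * K + 1) <= e.
  by rewrite -ler_pdivlMr// ge_min lexx orbT.
have [s /andP[s0 sn] rs] := H a a0.
apply: (le_trans rs).
have s2 : s ^+ 2 <= (n + a) ^+ 2 by rewrite ler_sqr ?nnegrE ?addr_ge0// ltW.
apply: (@le_trans _ _ (((n + a) ^+ 2 + 4 * (c + a)) * K)).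
  by rewrite ler_wpM2r// lerD2r.
have aa : a * a <= a by rewrite ger_pMl.
have : a * (2 * n + a + 4) * K <= a * (2 * n + 5) * K.
  rewrite ler_wpM2r// ler_wpM2l ?(ltW a0)//; lra.
lra.
Qed.

(** N and C_Theta may vanish, whereas the estimate for the mixture needs s > 0 and
    C > C_Theta; hence s < N + e and C = C_Theta + e, and e tends to 0. *)
Theorem theorem2p15 (R : realType) (E : polishMetricType R)
    (d : measure_display) (Theta : measurableType d) (m : probability Theta R)
    (mu : Theta -> probability (borel E) R)
    (mmu : forall A : set (borel E), measurable A ->
       measurable_fun [set: Theta] (fun t => mu t A))
    (hC : (unif_T1_const mu < +oo)%E)
    (x0 : E) (hN : (mean_dist_psi2 m mu x0 < +oo)%E) :
  (exists C : R, T1_ineq (mixture m mmu) C) /\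
  (T1_const (mixture m mmu) <=
    (mean_dist_psi2 m mu x0 ^+ 2 + 4%:E * unif_T1_const mu)
    * (1 + 3 / 2 * ln 2)%:E)%E.
Proof.
have C0 := unif_T1_const_ge0 mu; have N0 := mean_dist_psi2_ge0 m mu x0.
have Cfin : unif_T1_const mu \is a fin_num by rewrite ge0_fin_numE.
have Nfin : mean_dist_psi2 m mu x0 \is a fin_num by rewrite ge0_fin_numE.
pose c := fine (unif_T1_const mu); pose n := fine (mean_dist_psi2 m mu x0).
have c0 : 0 <= c by exact: fine_ge0.
have n0 : 0 <= n by exact: fine_ge0.
have T1mix e : 0 < e -> exists2 s, 0 < s < n + e &
    T1_ineq (mixture m mmu) ((s ^+ 2 + 4 * (c + e)) * (1 + 3 / 2 * ln 2)).
  move=> e0; have : (mean_dist_psi2 m mu x0 < (n + e)%:E)%E.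
    by rewrite -(fineK Nfin) lte_fin ltrDl.
  move=> /ereal_inf_lt[_ [s [s0 hs] <-]]; rewrite lte_fin => sn.
  exists s; first by rewrite s0.
  apply: (@mixture_T1_ineq _ _ _ _ _ _ _ x0) => //.
    by rewrite ltr_wpDl.
  by rewrite -(fineK Cfin) lte_fin ltrDl.
split; first by have [s _ ?] := T1mix 1 ltr01; eexists; eassumption.
have Tle C : T1_ineq (mixture m mmu) C -> (T1_const (mixture m mmu) <= C%:E)%E.
  by move=> TC; apply: ereal_inf_lbound; exists C.
have Tfin : T1_const (mixture m mmu) \is a fin_num.
  rewrite ge0_fin_numE ?T1_const_ge0//.
  by have [s _ /Tle/le_lt_trans] := T1mix 1 ltr01; apply; exact: ltry.
rewrite -(fineK Tfin) -(fineK Nfin) -(fineK Cfin) -EFin_expe -!EFinM.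
rewrite lee_fin; apply: le_of_sqr_perturbation => //.
  by rewrite addr_ge0// mulr_ge0// ln_ge0// ler1n.
move=> e e0; have [s sn /Tle] := T1mix e e0.
by rewrite -{1}(fineK Tfin) lee_fin; exists s.
Qed.
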